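(* Let $q$ be a real number with $0<q<\infty$. The space $\mathcal{D}_{\mathbb{R}}$ of persistence diagrams over $\mathbb{R}$, equipped with the Wasserstein $q$-metric $W^q$, does not have property A.
   Context: Let $\Delta_{\mathbb{R}}=\{(s,s): s\in\mathbb{R}\}$. A (persistence) diagram on $\mathbb{R}$ is a function $D\colon\mathbb{R}^2\to\mathbb{Z}_{\ge 0}$ such that $D(p)=0$ for all but finitely many $p\in\mathbb{R}^2$ and $D(p)=0$ for all $p\in\Delta_{\mathbb{R}}$. $\mathcal{D}_{\mathbb{R}}$ is the set of all such diagrams. The labeled diagram associated to $D$ is the finite set $\widetilde{D}=\{(x,i): x\in\mathbb{R}^2,\ 1\le i\le D(x)\}$. Functions of points of $\mathbb{R}^2$ are evaluated on elements $\tilde x=(x,i)$ of labeled diagrams by ignoring the label $i$. A partial matching of labeled diagrams $\widetilde{D}$ and $\widetilde{D}'$ is a subset $\tilde m\subseteq\widetilde{D}\times\widetilde{D}'$ in which each element of $\widetilde{D}$ and each element of $\widetilde{D}'$ occurs in at most one pair; $\pi_1(\tilde m)\subseteq\widetilde D$ and $\pi_2(\tilde m)\subseteq\widetilde D'$ denote its coordinate projections. With $\|\cdot\|_\infty$ the sup norm on $\mathbb{R}^2$, the Wasserstein $q$-metric is $$W^q(D,D')=\inf_{\tilde m}\left(\sum_{(\tilde x,\tilde y)\in\tilde m}\|\tilde x-\tilde y\|_\infty^q+\sum_{(x_1,x_2)\in\widetilde D\setminus\pi_1(\tilde m)}|x_1-x_2|^q+\sum_{(y_1,y_2)\in\widetilde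 D'\setminus\pi_2(\tilde m)}|y_1-y_2|^q\right)^{1/q},$$ where $\tilde m$ ranges over all partial matchings of $\widetilde D$ and $\widetilde D'$, and in the last two sums an unmatched labeled point is written via its underlying point of $\mathbb{R}^2$. A (discrete) space $X$ with distance $d$ has property A if for all $R>0$ and all $\epsilon>0$ there exists a family $\{A_x\}_{x\in X}$ of finite, nonempty subsets of $X\times\mathbb{N}$ such that (1) for all $x,y\in X$ with $d(x,y)\le R$ we have $\frac{\#(A_x\Delta A_y)}{\#(A_x\cap A_y)}\le\epsilon$ (in particular $A_x\cap A_y\neq\emptyset$), and (2) there exists $B>0$ such that for every $x\in X$, if $(y,n)\in A_x$ then $d(x,y)\le B$. Here $\#A$ is cardinality and $\Delta$ is symmetric difference. In the claim, this condition is applied verbatim with $X=\mathcal{D}_{\mathbb{R}}$ and $d=W^q$. *)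

(* Defs.v *)
From HB Require Import structures.
From mathcomp Require Import all_boot all_order all_algebra finmap.
From mathcomp Require Import all_classical all_reals all_analysis.
Set Implicit Arguments.
Unset Strict Implicit.
Unset Printing Implicit Defensive.
Import Order.TTheory GRing.Theory Num.Theory numFieldNormedType.Exports.
Local Open Scope ring_scope.
Local Open Scope fset_scope.

Section Diagrams.
Variable R : realType.

Record diagram := Diagram {
  dgm_fun :> {fsfun R * R -> nat with 0%N};
  _ : `[< forall s : R, dgm_fun (s, s) = 0%N >] }.

HB.instance Definition _ := [isSub for dgm_fun].
HB.instance Definition _ := [Choice of diagram by <:].

Local Notation lpoint := ((R * R) * nat)%type.

Definition labeled (D : diagram) : {fset lpoint} :=
  [fset ((x, i) : lpoint) | x in finsupp D, i in iota 1 (D x)].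

Definition partial_matching (D D' : diagram) (m : {fset lpoint * lpoint}) :
    Prop :=
  [/\ m `<=` labeled D `*` labeled D',
      {in m &, injective fst} & {in m &, injective snd}].

(* The norm on [R * R] in the first sum is the library's product norm, i.e.
   the sup norm. *)
Definition matching_cost (q : R) (D D' : diagram)
    (m : {fset lpoint * lpoint}) : R :=
  (\sum_(u <- m) `|u.1.1 - u.2.1| `^ q
   + \sum_(x <- labeled D `\` [fset u.1 | u in m]) `|x.1.1 - x.1.2| `^ q
   + \sum_(y <- labeled D' `\` [fset u.2 | u in m]) `|y.1.1 - y.1.2| `^ q)
  `^ q^-1.

(* The set of costs is nonempty (the empty matching is allowed) and bounded
   below by 0, so the real-valued [inf] is the genuine infimum. *)
Definition wasserstein (q : R) (D D' : diagram) : R :=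
  inf [set matching_cost q D D' m | m in partial_matching D D']%classic.

End Diagrams.

(* Since [x / 0 = 0] in MathComp, the nonemptiness of [A x `&` A y], implicit
   in the bound on the quotient, is stated separately. *)
Definition property_A (R : realType) (X : choiceType) (d : X -> X -> R) : Prop :=
  forall r eps : R, 0 < r -> 0 < eps ->
  exists A : X -> {fset X * nat},
    [/\ forall x, A x != fset0,
        forall x y, d x y <= r ->
          A x `&` A y != fset0 /\
          #|` (A x `\` A y) `|` (A y `\` A x)|%:R / #|` A x `&` A y|%:R <= eps
      & exists B : R, 0 < B /\
          forall (x y : X) (n : nat), (y, n) \in A x -> d x y <= B].

(* Main.v *)
Require Import Defs.
From mathcomp Require Import all_boot all_order all_algebra finmap.
From mathcomp Require Import all_classical all_reals all_analysis.
From mathcomp Require Import zify lra.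

(** Diagrams contain Hamming cubes of every dimension, coarsely and with
constants that do not depend on the dimension, and large Hamming cubes are
too expanding for property A.

The vertex [x] of the [n]-cube becomes the diagram [cube_dgm R x] with one
point [spot i = (4i, 4i+4)] for every [i] with [x i].  Flipping a coordinate
moves this diagram by a bounded amount ([wasserstein_flip]).  Conversely, if
[cube_dgm R x] and [cube_dgm R y] are both matched to one diagram [z] at cost
at most [S] (before taking the [q]-th root), then [x] and [y] differ in at most
[4 S] coordinates: if [spot i] occurs only in the first diagram, then either it
pays at least 1 in the first matching, or it is matched to a point [w] of [z]
at distance less than 1, and then [w] is too far from the diagonal and from
every other spot to pay less than 1 in the second matching
([cube_dgm_gap]).  The common neighbour [z] is arbitrary because the sets [A_x]
of property A may leave the image of the cube.

Suppose now that sets [A_x] are given for [eps = 1], with [x] restricted to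
the [n]-cube.  For a fixed element [k], the vertices [x] with [k] in [A_x]
form a set [V] of bounded diameter [d], and such a set has few internal edges:
at most [2 d #|V|] oriented ones, by counting those that approach a fixed
vertex of [V] ([internal_edges_le]).  Summing over [k], the total size of the
intersections of [A_x] with [A_y] over oriented edges [(x, y)] is at most
[2 d] times the total size of the [A_x].  On the other hand, each intersection
has at least half of the elements of [A_x], so the same total is at least
[n / 2] times the total size of the [A_x].  Hence [n <= 4 d]
([cube_dim_le]), which fails for large [n]. *)

Set Implicit Arguments.
Unset Strict Implicit.
Unset Printing Implicit Defensive.
Import Order.TTheory GRing.Theory Num.Theory numFieldNormedType.Exports.
Local Open Scope fset_scope.
Local Open Scope ring_scope.

(** * Edge counting in Hamming cubes *)

Definition flip {n : nat} (x : {ffun 'I_n -> bool}) (i : 'I_n) :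
  {ffun 'I_n -> bool} := [ffun j => x j (+) (j == i)].

Definition hamming {n : nat} (x y : {ffun 'I_n -> bool}) : nat :=
  (\sum_i (x i != y i))%N.

Lemma flipK n (i : 'I_n) : involutive (flip ^~ i).
Proof. by move=> x; apply/ffunP => j; rewrite !ffunE -addbA addbb addbF. Qed.

Lemma flip_neq n (x v : {ffun 'I_n -> bool}) i :
  (flip x i i != v i) = (x i == v i).
Proof. by rewrite ffunE eqxx addbT; case: (x i); case: (v i). Qed.

(** Flipping [i] exchanges the oriented edges that approach [v] with those that
move away from it, so that it suffices to count the former: a vertex [x] has
only [hamming x v] of them. *)
Lemma internal_edges_le n (V : pred {ffun 'I_n -> bool}) v d :
  (forall x, V x -> (hamming x v <= d)%N) ->
  (\sum_x \sum_i (V x && V (flip x i)) <= 2 * d * \sum_x V x)%N.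
Proof.
move=> Vd.
(* [T] counts the oriented internal edges that approach [v]; by [TE], equally
   many move away from it. *)
pose T := (\sum_x \sum_i [&& V x, V (flip x i) & x i != v i])%N.
have TE : T = (\sum_x \sum_i [&& V x, V (flip x i) & x i == v i])%N.
  rewrite /T exchange_big [RHS]exchange_big; apply: eq_bigr => i _ /=.
  rewrite (reindex_inj (inv_inj (@flipK _ i))) /=; apply: eq_bigr => x _.
  by rewrite flipK flip_neq andbCA.
have -> : (\sum_x \sum_i (V x && V (flip x i)) = T + T)%N.
  rewrite {2}TE -big_split; apply: eq_bigr => x _.
  rewrite -big_split; apply: eq_bigr => i _ /=.
  by case: (V x); case: (V _); case: (x i); case: (v i).
suff : (T <= d * \sum_x V x)%N by lia.
rewrite big_distrr /=; apply: leq_sum => x _.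
case Vx: (V x); last by rewrite big1.
rewrite muln1; apply: leq_trans (Vd _ Vx).
by apply: leq_sum => i _ /=; case: (V _); case: (_ != _).
Qed.

Lemma sum_mem_fset (K : choiceType) (A U : {fset K}) :
  A `<=` U -> #|` A| = (\sum_(k <- U) (k \in A))%N.
Proof.
move=> AU; rewrite card_fset_sum1.
rewrite (eq_big_seq (fun k => nat_of_bool (k \in A))); last by move=> k ->.
by apply: big_fset_incl => // k _ /negbTE ->.
Qed.

(** The combinatorial obstruction.  The last two hypotheses bound the number of
triples [(x, i, k)] with [k] in [A x] and in [A (flip x i)]: the former from
below, the latter, through the sets of vertices that share [k], from above. *)
Lemma cube_dim_le (n d : nat) (K : choiceType)
    (A : {ffun 'I_n -> bool} -> {fset K}) :
    (forall x, A x != fset0) ->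
    (forall x i, (#|` A x| <= 2 * #|` A x `&` A (flip x i)|)%N) ->
    (forall x y k, k \in A x -> k \in A y -> (hamming x y <= d)%N) ->
  (n <= 4 * d)%N.
Proof.
move=> A0 Aflip Adiam.
pose U := \bigcup_(x <- enum {ffun 'I_n -> bool}) A x.
have AU x : A x `<=` U.
  by apply: bigfcup_sup => //; rewrite mem_enum.
pose N := (\sum_x #|` A x|)%N.
have N0 : (0 < N)%N.
  rewrite /N (bigD1 [ffun=> false]) //= ltn_addr // cardfs_gt0; exact: A0.
have NE : N = (\sum_(k <- U) \sum_x (k \in A x))%N.
  by rewrite exchange_big; apply: eq_bigr => x _ /=; apply: sum_mem_fset.
have inner : (\sum_x \sum_i #|` A x `&` A (flip x i)| <= 2 * d * N)%N.
  under eq_bigr => x _ do under eq_bigr => i _ do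
    rewrite (@sum_mem_fset _ _ U (fsubset_trans (fsubsetIl _ _) (AU x))).
  under eq_bigr => x _ do rewrite exchange_big.
  rewrite exchange_big NE big_distrr /= big_seq [leqRHS]big_seq.
  apply: leq_sum => k /bigfcupP [v _ kv].
  rewrite (eq_bigr (fun x => \sum_i ((k \in A x) && (k \in A (flip x i))))%N).
    by apply: (@internal_edges_le _ (fun x => k \in A x) v d) => x kx;
      apply: Adiam kx kv.
  by move=> x _; apply: eq_bigr => i _; rewrite inE.
have outer : (n * N <= 2 * \sum_x \sum_i #|` A x `&` A (flip x i)|)%N.
  rewrite !big_distrr /=; apply: leq_sum => x _.
  rewrite big_distrr /= -[X in (X * _)%N]card_ord -sum_nat_const.
  by apply: leq_sum => i _; apply: Aflip.
by rewrite -(leq_pmul2r N0); lia.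
Qed.

(** * Matchings and their costs *)

Lemma card_le_sum (R : realType) (T : choiceType) (P S : {fset T}) (f : T -> R) :
  P `<=` S -> (forall a, 0 <= f a) -> (forall a, a \in P -> 1 <= f a) ->
  #|` P|%:R <= \sum_(a <- S) f a.
Proof.
move=> PS f0 f1; rewrite (sum_mem_fset PS) natr_sum.
by apply: ler_sum => a _; have [/f1|_] := boolP (a \in P).
Qed.

Local Notation lpoint R := ((R * R) * nat)%type.

(** The quantity whose [q]-th root is [matching_cost]; the proof works with it
because it is additive over points. *)
Definition matching_sum (R : realType) (q : R) (D D' : diagram R)
    (m : {fset lpoint R * lpoint R}) : R :=
  \sum_(u <- m) `|u.1.1 - u.2.1| `^ q
   + \sum_(x <- labeled D `\` [fset u.1 | u in m]) `|x.1.1 - x.1.2| `^ q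
   + \sum_(y <- labeled D' `\` [fset u.2 | u in m]) `|y.1.1 - y.1.2| `^ q.

Lemma matching_sum_ge0 (R : realType) (q : R) (D D' : diagram R) m :
  0 <= matching_sum q D D' m.
Proof.
by rewrite /matching_sum !addr_ge0 ?sumr_ge0// => *; exact: powR_ge0.
Qed.

Lemma wasserstein_le (R : realType) (q : R) (D D' : diagram R) m :
  partial_matching D D' m ->
  wasserstein q D D' <= matching_sum q D D' m `^ q^-1.
Proof.
move=> mP; apply: ge_inf; last by exists m.
by exists 0 => _ [m' _ <-]; exact: powR_ge0.
Qed.

Lemma partial_matching0 (R : realType) (D D' : diagram R) :
  partial_matching D D' fset0.
Proof. by split => [|u|u]; rewrite ?fsub0set ?inE. Qed.

Lemma wasserstein_lt_matching (R : realType) (q b : R) (D D' : diagram R) :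
  0 < q -> wasserstein q D D' < b ->
  exists2 m, partial_matching D D' m & matching_sum q D D' m < b `^ q.
Proof.
move=> q0 Wb.
have [|_ [m mP <-] mb] := inf_lt _ Wb.
  by eexists; exists fset0 => //; exact: partial_matching0.
exists m => //; rewrite -[ltLHS]powRr1 ?matching_sum_ge0//.
rewrite -(mulVf (lt0r_neq0 q0)) powRrM.
have b0 : 0 <= b by rewrite ltW// (le_lt_trans _ mb) ?powR_ge0.
by rewrite gt0_ltr_powR// nnegrE ?powR_ge0.
Qed.

Lemma mem_labeled (R : realType) (D : diagram R) (p : R * R) i :
  ((p, i) \in labeled D) = (0 < i <= D p)%N.
Proof.
apply/imfset2P/idP => /= [[p' _ [i' i'D [-> ->]]]|iD].
  by move: i'D; rewrite mem_iota add1n ltnS.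
exists p; first by rewrite mem_finsupp -lt0n; case/andP: iD; apply: leq_trans.
by exists i => //; rewrite mem_iota add1n ltnS.
Qed.

(** The points that certainly pay at least 1: both distances are bounded, the one
to the diagonal, which an unmatched point pays, and the one to a partner.  The
projection [p] is [fst] or [snd], so that both sides of a matching are treated
at once. *)
Definition far (R : realType) (p : lpoint R * lpoint R -> lpoint R)
    (L : {fset lpoint R}) (m : {fset lpoint R * lpoint R}) : {fset lpoint R} :=
  [fset a in L | (1 <= `|a.1.1 - a.1.2|) &&
     all (fun u => (p u == a) ==> (1 <= `|u.1.1 - u.2.1|)) m].

Lemma mem_far (R : realType) p L m (a : lpoint R) :
  (a \in far p L m) = [&& a \in L, 1 <= `|a.1.1 - a.1.2| &
    all (fun u => (p u == a) ==> (1 <= `|u.1.1 - u.2.1|)) m].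
Proof. by rewrite !inE. Qed.

Lemma powR_ge1 (R : realType) (q a : R) : 0 < q -> 1 <= a -> 1 <= a `^ q.
Proof.
move=> q0 a1; have <- : 1 `^ q = 1 :> R by rewrite powR1.
by rewrite ge0_ler_powR ?nnegrE ?(ltW q0)// (le_trans ler01).
Qed.

(** Unmatched points pay in the diagonal sum and matched ones in the sum over
the matching, where distinct points belong to distinct pairs. *)
Lemma card_far (R : realType) (q : R) p L m : 0 < q ->
  #|` @far R p L m|%:R <= \sum_(u <- m) `|u.1.1 - u.2.1| `^ q
    + \sum_(x <- L `\` [fset p u | u in m]) `|x.1.1 - x.1.2| `^ q.
Proof.
move=> q0; rewrite -(cardfsID [fset p u | u in m]) natrD lerD//.
  pose U := [fset u in m | 1 <= `|u.1.1 - u.2.1|].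
  have sub : far p L m `&` [fset p u | u in m] `<=` [fset p u | u in U].
    apply/fsubsetP => a; rewrite !inE /= => /andP[/and3P[_ _ /allP am]].
    case/imfsetP => u /= um ap; rewrite ap in_imfset//= !inE um /=.
    by have := am u um; rewrite ap eqxx.
  have cU : (#|` far p L m `&` [fset p u | u in m]| <= #|` U|)%N.
    apply: leq_trans (fsubset_leq_card sub) _; exact: leq_imfset_card.
  apply: (@le_trans _ _ #|` U|%:R); first by rewrite ler_nat.
  apply: card_le_sum => [|u|u]; rewrite ?powR_ge0//.
    by apply/fsubsetP => u; rewrite !inE => /andP[].
  by rewrite !inE => /andP[_ ?]; rewrite powR_ge1.
apply: card_le_sum => [|u|u]; rewrite ?powR_ge0//.
  by rewrite fsetSD//; apply/fsubsetP => u; rewrite !inE => /andP[].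
by rewrite !inE => /and3P[_ _ /andP[? _]]; rewrite powR_ge1.
Qed.

(** * Hamming cubes of diagrams *)

(** The spacing 4 keeps the open unit balls around the spots pairwise disjoint
and away from the points [w] with [`|w.1 - w.2| < 1]. *)
Definition spot {R : realType} (i : nat) : R * R := (4 * i%:R, 4 * i%:R + 4).

Lemma spot_near (R : realType) i (w : R * R) :
  `|spot i - w| < 1 -> 1 <= `|w.1 - w.2|.
Proof.
rewrite prod_normE /= gt_max !ltr_norml => /andP[/andP[? ?] /andP[? ?]].
by rewrite ler_normr; apply/orP; right; lra.
Qed.

Lemma spot_sep (R : realType) i j (w : R * R) :
  `|spot i - w| < 1 -> `|spot j - w| < 1 -> i = j.
Proof.
wlog ij : i j / (i <= j)%N => [H di dj|].
  by case: (leqP i j) => [|/ltnW] ?; [|symmetry]; apply: H.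
rewrite !prod_normE /= !gt_max !ltr_norml.
move=> /andP[/andP[? ?] _] /andP[/andP[? ?] _].
apply/eqP; rewrite eqn_leq ij leqNgt; apply/negP => ltij.
have : (i.+1%:R <= j%:R :> R) by rewrite ler_nat.
by rewrite -natr1; lra.
Qed.

Lemma spot_inj (R : realType) : injective (@spot R).
Proof.
move=> i j ij; apply: (@spot_sep R i j (spot i));
  by rewrite ?ij subrr normr0.
Qed.

Definition cube_supp {R : realType} {n} (x : {ffun 'I_n -> bool}) :
  {fset R * R} := [fset spot (val i) | i in 'I_n & x i].

Lemma cube_offdiag (R : realType) n (x : {ffun 'I_n -> bool}) :
  `[< forall s : R, [fsfun p in cube_supp x => 1%N | 0%N] (s, s) = 0%N >].
Proof.
apply/asboolP => s; rewrite fsfunE; case: ifP => // /imfsetP [i _ []] ->.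
by move=> /eqP; rewrite eq_sym addrC -subr_eq0 addrK pnatr_eq0.
Qed.

Definition cube_dgm (R : realType) n (x : {ffun 'I_n -> bool}) : diagram R :=
  Diagram (cube_offdiag R x).

Lemma mem_cube_dgm (R : realType) n (x : {ffun 'I_n -> bool}) (a : lpoint R) :
  reflect (exists2 i, x i & a = (spot i, 1%N)) (a \in labeled (cube_dgm R x)).
Proof.
case: a => p k; rewrite mem_labeled /= fsfunE; apply: (iffP idP) => [|[i xi [-> ->]]].
  case: ifP => [/imfsetP [i /= xi ->]|_]; last by case: k.
  by case: k => [|[]]// _; exists i.
by have -> : spot i \in @cube_supp R n x by apply/imfsetP; exists i.
Qed.

(** The identity matching of the common points leaves at most [spot i]
unmatched, on one side or the other; allowing it on both sides avoids
distinguishing whether it is added or removed. *)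
Lemma wasserstein_flip (R : realType) (q : R) n (x : {ffun 'I_n -> bool}) i :
  0 < q ->
  wasserstein q (cube_dgm R x) (cube_dgm R (flip x i)) <=
    (4 `^ q + 4 `^ q) `^ q^-1.
Proof.
move=> q0; pose L := labeled (cube_dgm R x).
pose L' := labeled (cube_dgm R (flip x i)).
pose m : {fset lpoint R * lpoint R} := [fset (a, a) | a in L `&` L'].
have m1 : [fset u.1 | u in m] = L `&` L'.
  apply/fsetP => a; apply/imfsetP/idP => /= [[_ /imfsetP[b bL ->] ->]//|aL].
  by exists (a, a) => //; rewrite in_imfset.
have m2 : [fset u.2 | u in m] = L `&` L'.
  apply/fsetP => a; apply/imfsetP/idP => /= [[_ /imfsetP[b bL ->] ->]//|aL].
  by exists (a, a) => //; rewrite in_imfset.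
have mP : partial_matching (cube_dgm R x) (cube_dgm R (flip x i)) m.
  split.
  - apply/fsubsetP => _ /imfsetP[b /= bL ->]; move: bL.
    by rewrite inE in_fsetM.
  - by move=> _ _ /imfsetP[b _ ->] /imfsetP[c _ ->] /= ->.
  - by move=> _ _ /imfsetP[b _ ->] /imfsetP[c _ ->] /= ->.
apply: le_trans (wasserstein_le q mP) _.
apply: ge0_ler_powR; rewrite ?invr_ge0 ?(ltW q0)// ?nnegrE ?matching_sum_ge0
  ?addr_ge0 ?powR_ge0//.
have side S : S `<=` [fset ((spot i : R * R), 1%N) : lpoint R] ->
    \sum_(a <- S) `|a.1.1 - a.1.2| `^ q <= 4 `^ q.
  rewrite fsubset1 => /orP[] /eqP ->; last by rewrite big_seq_fset0 powR_ge0.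
  rewrite big_seq_fset1 /= ge0_ler_powR ?nnegrE ?(ltW q0)//.
  by rewrite ler_norml; apply/andP; split; lra.
rewrite /matching_sum m1 m2 big1_fset ?add0r.
  apply: lerD; apply: side; apply/fsubsetP => a;
    rewrite in_fset1 in_fsetD in_fsetI negb_and.
    rewrite -/L -/L' => /andP[+ aL]; rewrite aL /=.
    case/mem_cube_dgm: aL => j xj ->; case: (eqVneq j i) => [->//|ji] /negP[].
    by apply/mem_cube_dgm; exists j => //; rewrite ffunE xj (negbTE ji).
  rewrite -/L -/L' => /andP[+ aL]; rewrite aL orbF.
  case/mem_cube_dgm: aL => j xj ->; case: (eqVneq j i) => [->//|ji] /negP[].
  by apply/mem_cube_dgm; exists j => //; move: xj; rewrite ffunE (negbTE ji) addbF.
move=> _ /imfsetP[b _ ->] _ /=.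
by rewrite subrr normr0 powR0 ?lt0r_neq0.
Qed.

(** Each spot occurring only in the first diagram is charged to a point that
pays at least 1: itself in [m1], or its partner in [z] for [m2].  Both charges
are injective. *)
Lemma cube_dgm_gap (R : realType) (q : R) n (x y : {ffun 'I_n -> bool})
    (z : diagram R) m1 m2 (S : nat) : 0 < q ->
    partial_matching (cube_dgm R x) z m1 ->
    partial_matching (cube_dgm R y) z m2 ->
    matching_sum q (cube_dgm R x) z m1 <= S%:R ->
    matching_sum q (cube_dgm R y) z m2 <= S%:R ->
  (\sum_i (x i && ~~ y i) <= 2 * S)%N.
Proof.
move=> q0 [m1s _ m1i] [m2s _ _] c1 c2.
pose F1 := far fst (labeled (cube_dgm R x)) m1.
pose F2 := far snd (labeled z) m2.
have cF1 : (#|` F1| <= S)%N.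
  rewrite -(ler_nat R); apply: le_trans c1; apply: le_trans (card_far _ _ _ q0) _.
  by rewrite /matching_sum lerDl sumr_ge0// => *; exact: powR_ge0.
have cF2 : (#|` F2| <= S)%N.
  rewrite -(ler_nat R); apply: le_trans c2; apply: le_trans (card_far _ _ _ q0) _.
  rewrite /matching_sum [leRHS]addrAC lerDl sumr_ge0// => *; exact: powR_ge0.
(* The pairs of [m1] through which spots are charged to their partners. *)
pose U := [fset u in m1 | u.2 \in F2].
have cU : (#|` U| <= S)%N.
  have <- : #|` [fset u.2 | u in U]| = #|` U|.
    rewrite card_in_imfset // => u v.
    by rewrite !inE => /andP[um _] /andP[vm _]; exact: m1i.
  apply: leq_trans cF2; apply: fsubset_leq_card.
  apply/fsubsetP => _ /imfsetP[u /= uU ->].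
  by move: uU; rewrite !inE => /andP[].
pose J : {fset lpoint R} := [fset (spot (val i), 1%N) | i in 'I_n & x i && ~~ y i].
have -> : (\sum_i (x i && ~~ y i))%N = #|` J|.
  rewrite card_imfset; last by move=> i j /(congr1 fst) /= /spot_inj /ord_inj.
  rewrite /= size_filter -sum1_count [RHS]big_mkcond enumT.
  by rewrite /index_enum; unlock; apply: eq_bigr.
have JF : J `<=` F1 `|` [fset u.1 | u in U].
  apply/fsubsetP => _ /imfsetP[i /= /andP[xi yi] ->].
  have aL : (spot i : R * R, 1%N) \in labeled (cube_dgm R x).
    by apply/mem_cube_dgm; exists i.
  rewrite inE; apply/orP.
  have [aF|aF] := boolP ((spot i, 1%N) \in F1); [by left|right].
  move: aF; rewrite /F1 mem_far /= aL /= negb_and => /orP[|/allPn[u um]].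
    rewrite ler_normr => /negP[]; apply/orP; right; lra.
  rewrite negb_imply -ltNge => /andP[/eqP u1 du].
  have := fsubsetP m1s _ um; rewrite in_fsetM => /andP[_ wL].
  apply/imfsetP; exists u => //=; rewrite !inE um wL /=.
  move: du; rewrite u1 /= => du.
  rewrite (spot_near du) /=; apply/allP => v vm; apply/implyP => /eqP v2.
  rewrite leNgt; apply/negP => dv.
  (* [m2] would match the partner of [spot i] to some [spot j] at distance
     less than 1, which forces [i = j], although [spot i] is not available. *)
  have := fsubsetP m2s _ vm; rewrite in_fsetM => /andP[/mem_cube_dgm [j yj v1] _].
  move: dv; rewrite v1 v2 /= => dv.
  by have /ord_inj ij := spot_sep du dv; move: yi; rewrite ij yj.
apply: leq_trans (fsubset_leq_card JF) _; apply: leq_trans (leq_card_fsetU _ _) _.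
rewrite mul2n -addnn leq_add//; apply: leq_trans cU; exact: leq_imfset_card.
Qed.

Theorem theorem3p9 (R : realType) (q : R) (hq : 0 < q) :
  ~ property_A (@wasserstein R q).
Proof.
pose r : R := (4 `^ q + 4 `^ q) `^ q^-1.
have r0 : 0 < r by rewrite powR_gt0// addr_gt0// powR_gt0.
move=> /(_ r 1 r0 ltr01) [A [A0 Aclose [B [B0 AB]]]].
(* The slack in [B + 1] leaves room for a matching whose cost exceeds the
   infimum. *)
pose S := Num.bound ((B + 1) `^ q).
(* [2 * S] coordinates for each direction in which two vertices can differ. *)
pose d := (4 * S)%N; pose n := (4 * d).+1.
suff : (n <= 4 * d)%N by rewrite ltnn.
pose f x := @cube_dgm R n x.
apply: (@cube_dim_le n d _ (A \o f)) => [x|x i|x y [z k] xz yz] /=.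
- exact: A0.
- have [I0] := Aclose _ _ (wasserstein_flip x i hq).
  rewrite -/(f x) -/(f (flip x i)) ler_pdivrMr ?mul1r ?ler_nat ?ltr0n ?cardfs_gt0// => H.
  rewrite -(cardfsID (A (f (flip x i)))) mul2n -addnn leq_add2l.
  by apply: leq_trans H; apply: fsubset_leq_card; exact: fsubsetUl.
- have near w : (z, k) \in A (f w) -> exists2 m, partial_matching (f w) z m &
      matching_sum q (f w) z m <= S%:R.
    move=> /AB wB; have [||m mP mS] := @wasserstein_lt_matching R q (B + 1) (f w) z => //.
      by rewrite (le_lt_trans wB)// ltrDl.
    exists m => //; rewrite ltW// (lt_trans mS)//.
    by apply: archi_boundP; exact: powR_ge0.
  have [m1 m1P m1S] := near _ xz; have [m2 m2P m2S] := near _ yz.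
  have -> : hamming x y = (\sum_i (x i && ~~ y i) + \sum_i (y i && ~~ x i))%N.
    rewrite -big_split; apply: eq_bigr => i _ /=.
    by case: (x i); case: (y i).
  have := cube_dgm_gap hq m1P m2P m1S m2S.
  have := cube_dgm_gap hq m2P m1P m2S m1S.
  by rewrite /d; lia.
Qed.
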